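(* Let $n\ge1$. Every frozen index for $\mathrm{Conf}_3^\times(\widetilde{\mathcal F\ell})$ has an optimized seed: for each frozen vertex $v_f$ of the initial quiver $Q$ there is a seed, obtained from the initial seed by a finite sequence of mutations at unfrozen vertices, that is optimized for $f$.
   Context: $Q$ has vertex set $\{v_{(a,b,c)}:(a,b,c)\in\mathbb Z_{\ge0}^3,\ a+b+c=n\}$; a vertex is unfrozen if $a,b,c>0$ and frozen otherwise. There is an arrow from $(a,b,c)$ to each of $(a-1,b+1,c),(a,b-1,c+1),(a+1,b,c-1)$ that is a vertex, except that arrows between two frozen vertices are omitted. Mutations are quiver mutations at unfrozen vertices; arrows between frozen vertices are always discarded. In this (skew-symmetric) situation a seed $s$ with quiver $Q_s$ is optimized for the frozen index $f$ if $v_f$ is a sink of $Q_s$, i.e. there is no arrow of $Q_s$ starting at $v_f$ (a vertex without arrows counts as a sink). *)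

(* Defs.v *)
From mathcomp Require Import all_boot.

Set Implicit Arguments.
Unset Strict Implicit.
Unset Printing Implicit Defensive.

Section Quivers.

Variable V : eqType.

(* [Q u v] is the number of arrows from u to v. *)
Definition quiver := V -> V -> nat.

Implicit Types (Q : quiver) (frozen : pred V) (k u v f : V).

Definition add_paths Q k : quiver :=
  fun u v => Q u v + Q u k * Q k v.

Definition reverse_at Q k : quiver :=
  fun u v => if (u == k) || (v == k) then Q v u else Q u v.

(* Truncated subtraction removes a maximal collection of disjoint 2-cycles. *)
Definition cancel_2cycles Q : quiver :=
  fun u v => Q u v - Q v u.

Definition discard_frozen frozen Q : quiver :=
  fun u v => if frozen u && frozen v then 0 else Q u v.

Definition mutate frozen Q k : quiver :=
  discard_frozen frozen (cancel_2cycles (reverse_at (add_paths Q k) k)).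

(* The mutations are performed from the head of [ks] on. *)
Definition mutate_seq frozen Q (ks : seq V) : quiver :=
  foldl (mutate frozen) Q ks.

(* [Qs] is the quiver of a seed obtained from the seed with quiver [Q] by
   finitely many mutations at unfrozen vertices. *)
Definition seed_quiver frozen Q (Qs : quiver) : Prop :=
  exists2 ks : seq V, all (predC frozen) ks & Qs = mutate_seq frozen Q ks.

(* In the skew-symmetric case, a seed is optimized for a frozen index f when
   the vertex f is a sink of its quiver. *)
Definition optimized Qs f : Prop := forall v, Qs f v = 0.

End Quivers.

Definition vertex (n : nat) : Type :=
  {t : nat * nat * nat | t.1.1 + t.1.2 + t.2 == n}.

Definition unfrozen (n : nat) (v : vertex n) : bool :=
  let: (a, b, c) := val v in [&& 0 < a, 0 < b & 0 < c].

Definition frozen (n : nat) (v : vertex n) : bool := ~~ unfrozen v.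

(* The steps are (-1, 1, 0), (0, -1, 1) and (1, 0, -1), with the decrement
   written as a successor on the other side. *)
Definition step (n : nat) (u v : vertex n) : bool :=
  let: (a, b, c) := val u in
  let: (a', b', c') := val v in
  [|| [&& a == a'.+1, b' == b.+1 & c' == c],
      [&& a' == a, b == b'.+1 & c' == c.+1]
    | [&& a' == a.+1, b' == b & c == c'.+1]].

Definition initial_quiver (n : nat) : quiver (vertex n) :=
  discard_frozen (@frozen n) (fun u v => nat_of_bool (step u v)).

Arguments frozen : clear implicits.
Arguments initial_quiver : clear implicits.

(* Main.v *)
Require Import Defs.
From mathcomp Require Import all_boot.
From mathcomp Require Import zify.

(**
By the cyclic symmetry of the quiver we may take f = (a, b, 0). Its only arrow
to an unfrozen vertex goes to (a, b-1, 1). Mutate successively at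
(a, b-1, 1), (a, b-2, 2), ..., (a, 1, b-1). When it is the turn of
w = (a, b-k, k), the only arrow from f goes to w, and w has at most two
arrows to unfrozen vertices: one to a vertex with an arrow to f, where the new
arrow from f cancels, and one to (a, b-k-1, k+1), which becomes the only
possible head of an arrow from f. The last such head, (a, 0, b), is frozen.
*)

Set Implicit Arguments.
Unset Strict Implicit.
Unset Printing Implicit Defensive.

(** * Entries of a mutated quiver *)

Section Mutation.

Variables (V : eqType) (fr : pred V).
Implicit Types (Q : quiver V) (u v k : V).

(** The case [u = v] excludes loops as well. *)
Definition acyclic2 Q := forall u v, Q u v = 0 \/ Q v u = 0.

Lemma mutate_acyclic2 Q k : acyclic2 (mutate fr Q k).
Proof.
move=> u v; rewrite /mutate /discard_frozen andbC.
by case: ifP => _; [left | rewrite /cancel_2cycles; lia].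
Qed.

Lemma mutate_discard Q k u v : fr u -> fr v -> mutate fr Q k u v = 0.
Proof. by rewrite /mutate /discard_frozen => -> ->. Qed.

Lemma mutate_from Q k v : acyclic2 Q -> ~~ fr k -> mutate fr Q k k v = Q v k.
Proof.
move=> acQ /negbTE frk.
have Qkk : Q k k = 0 by case: (acQ k k).
rewrite /mutate /discard_frozen frk /= /cancel_2cycles /reverse_at /add_paths.
by rewrite eqxx orbT Qkk /= !muln0 ?mul0n ?addn0; case: (acQ k v); lia.
Qed.

Lemma mutate_to Q k v : acyclic2 Q -> ~~ fr k -> mutate fr Q k v k = Q k v.
Proof.
move=> acQ /negbTE frk.
have Qkk : Q k k = 0 by case: (acQ k k).
rewrite /mutate /discard_frozen frk andbF /cancel_2cycles /reverse_at /add_paths.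
by rewrite eqxx orbT Qkk /= !muln0 ?mul0n ?addn0; case: (acQ k v); lia.
Qed.

Lemma mutate_away Q k u v : u != k -> v != k -> ~~ (fr u && fr v) ->
  mutate fr Q k u v = Q u v + Q u k * Q k v - (Q v u + Q v k * Q k u).
Proof.
move=> /negbTE uk /negbTE vk /negbTE fruv.
by rewrite /mutate /discard_frozen fruv /cancel_2cycles /reverse_at uk vk.
Qed.

(** Carries an optimizing sequence along a symmetry of the quiver: mutation at [phi k] computes the
    entries on the image of [phi] from such entries alone. *)
Lemma mutate_seq_transport (phi : V -> V) (Q1 Q2 : quiver V) ks :
    injective phi -> (forall v, fr (phi v) = fr v) ->
    (forall u v, Q1 (phi u) (phi v) = Q2 u v) ->
  forall u v,
    mutate_seq fr Q1 (map phi ks) (phi u) (phi v) = mutate_seq fr Q2 ks u v.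
Proof.
move=> inj_phi fr_phi; elim: ks Q1 Q2 => [|k ks IHks] //= Q1 Q2 Q12.
apply: IHks => u v; rewrite /mutate /discard_frozen !fr_phi.
rewrite /cancel_2cycles /reverse_at !(inj_eq inj_phi) /add_paths.
by rewrite !Q12.
Qed.

End Mutation.

(** * Pushing the arrow from [f] along a path *)

Section MutationAlongPath.

Variables (V : eqType) (fr : pred V) (Q0 : quiver V) (f : V).
Variables (w : nat -> V) (m : nat).

Hypothesis Q0_acyclic2 : acyclic2 Q0.
Hypothesis f_frozen : fr f.
Hypothesis w_unfrozen : forall j, j < m -> ~~ fr (w j).
Hypothesis wm_frozen : fr (w m).
Hypothesis w_inj : forall i j, i < j < m -> w i <> w j.
Hypothesis from_f : forall v, Q0 f v <= ~~ fr v && (v == w 0).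
Hypothesis path_arrow : forall j, j.+1 < m -> Q0 (w j) (w j.+1) = 1.
Hypothesis path_chordless :
  forall i j, i.+1 < j < m -> Q0 (w i) (w j) = 0 /\ Q0 (w j) (w i) = 0.
(** Arrows leaving the path close oriented triangles, so that mutation at [w j] cancels them against
    the paths [v -> w j -> w j.+1]. *)
Hypothesis path_triangle :
  forall j v, j.+1 < m -> Q0 (w j.+1) v <= Q0 v (w j) + (v == w j.+2).
(** Here [f] plays the part of a vertex preceding [w 0]. For frozen [v] the closing arrow to [f]
    would join two frozen vertices. *)
Hypothesis start_triangle :
  forall v, 0 < m -> ~~ fr v -> Q0 (w 0) v <= Q0 v f + (v == w 1).

(* The invariant after mutating at [w 0], ..., [w k.-1]. *)
Record path_inv (k : nat) (Q : quiver V) : Prop := PathInv {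
  inv_acyclic2 : acyclic2 Q;
  inv_from_f : forall v, Q f v <= ~~ fr v && (v == w k);
  inv_from_w : forall v, k < m -> ~~ fr v -> Q (w k) v <= Q v f + (v == w k.+1);
  inv_to_w : forall v, k.+1 < m -> 0 < Q0 (w k.+1) v ->
    Q0 v (w k) <= Q v (w k);
  inv_ahead : forall j v, k < j < m ->
    Q (w j) v = Q0 (w j) v /\ Q v (w j) = Q0 v (w j) }.

Lemma path_inv0 : path_inv 0 Q0.
Proof. by split. Qed.

(** Mutation at [w k] alters the arrows at [w k.+1], so [inv_ahead] has to give these up; [inv_to_w]
    keeps those that the next mutation needs for cancellation. *)
Lemma path_invS k Q : k < m -> 0 < Q f (w k) -> path_inv k Q ->
  path_inv k.+1 (mutate fr Q (w k)).
Proof.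
move=> km fk [acQ Af Bw Dw E].
have frk := w_unfrozen km.
have fNk : f != w k by apply: contraNneq frk => <-.
have nofr j v : j < m -> ~~ (fr (w j) && fr v) /\ ~~ (fr v && fr (w j)).
  by move=> /w_unfrozen /negbTE ->; rewrite andbF.
have wNk j : k < j < m -> w j != w k.
  by move=> kj; apply/eqP => /esym; apply: w_inj.
have Qfk : Q f (w k) = 1 by have := Af (w k); lia.
have back j : k < j < m -> Q (w j) (w k) = 0.
  move=> kjm; rewrite (E _ _ kjm).1.
  have [->|jk] := eqVneq j k.+1.
    have := @path_arrow k; have := Q0_acyclic2 (w k) (w k.+1).
    by case=> [->|//]; lia.
  by have [] := @path_chordless k j; lia.
split.
- exact: mutate_acyclic2.
- move=> v; case frv: (fr v); first by rewrite mutate_discard.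
  have [->|vk] := eqVneq v (w k).
    by rewrite mutate_to //; case: (acQ f (w k)) => [|->]; lia.
  (* The paths [f -> w k -> v] cancel against the arrows [v -> f], except possibly one with
     [v = w k.+1]. *)
  rewrite mutate_away // ?frv ?andbF // Qfk mul1n.
  have := Af v; have := Bw v km; rewrite (negbTE vk) frv /=.
  by move=> /(_ isT); lia.
- move=> v k1m frv; have [->|vk] := eqVneq v (w k).
    (* The reversed arrow [w k.+1 -> w k] is matched by the reversed arrow [w k -> f]. *)
    rewrite mutate_to // mutate_from // Qfk.
    have [_ ->] := E k.+1 (w k) ltac:(lia).
    by rewrite path_arrow.
  rewrite mutate_away ?wNk ?(nofr _ _ k1m).1 //; try lia.
  rewrite back; last lia.
  have [E1 _] := E k.+1 v ltac:(lia); rewrite E1.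
  have [_ E2] := E k.+1 (w k) ltac:(lia); rewrite E2 path_arrow //.
  (* By [Dw], enough paths [v -> w k -> w k.+1] have survived to cancel the arrows that close
     triangles. *)
  have := @path_triangle k v k1m; have := Dw v k1m.
  by case: (posnP (Q0 (w k.+1) v)) => [->|_ /(_ isT)]; lia.
- move=> v k2m v_out; have vk : v != w k.
    apply: contraTneq v_out => ->.
    by have [_ ->] := @path_chordless k k.+2 ltac:(lia).
  have k1m : k.+1 < m by lia.
  rewrite mutate_away ?wNk ?(nofr _ _ k1m).2 //; try lia.
  rewrite (back k.+1); last lia.
  have [-> ->] := E k.+1 v ltac:(lia).
  (* Arrows into [w k.+1] are only gained: if [Q0 v (w k.+1)] is positive, the subtracted term
     vanishes. *)
  by case: (Q0_acyclic2 v (w k.+1)) => ->; lia.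
- move=> j v kjm; have jm : j < m by lia.
  have kjm' : k < j < m by lia.
  have [wkj wjk] := @path_chordless k j kjm.
  have [->|vk] := eqVneq v (w k).
    rewrite mutate_to // mutate_from //.
    by have [-> ->] := E j (w k) kjm'; rewrite wkj wjk.
  rewrite !mutate_away ?wNk ?(nofr _ v jm).1 ?(nofr _ v jm).2 //.
  have [-> ->] := E j v kjm'.
  have [-> ->] := E j (w k) kjm'; rewrite wkj wjk !muln0 !mul0n !addn0.
  by case: (Q0_acyclic2 v (w j)) => ->; lia.
Qed.

(** Here [d] bounds the mutations still to come. If the arrow to [w k] is missing, [f] is already a
    sink and the sequence stops; at [k = m] the only possible head is frozen. *)
Lemma path_inv_optimized d k Q : k + d = m -> path_inv k Q ->
  exists2 ks, all (predC fr) ks & optimized (mutate_seq fr Q ks) f.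
Proof.
elim: d k Q => [|d IHd] k Q kdm invQ.
  exists [::] => // v; have := inv_from_f invQ v.
  rewrite -[k]addn0 kdm; have [->|_] := eqVneq v (w m).
    by rewrite wm_frozen leqn0 => /eqP.
  by rewrite andbF leqn0 => /eqP.
have km : k < m by lia.
have [fk0|fk] := posnP (Q f (w k)).
  exists [::] => // v; have := inv_from_f invQ v.
  by have [->|_] := eqVneq v (w k); last by rewrite andbF leqn0 => /eqP.
have [|ks ks_unfr opt] := IHd k.+1 _ _ (path_invS km fk invQ); first by lia.
by exists (w k :: ks) => //=; rewrite w_unfrozen.
Qed.

Lemma path_optimized :
  exists2 ks, all (predC fr) ks & optimized (mutate_seq fr Q0 ks) f.
Proof. exact: path_inv_optimized (add0n m) path_inv0. Qed.

End MutationAlongPath.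

(** * The triangular quiver and its rotation *)

Section Triangle.

Lemma leq_bool_add (p q r : bool) : (p -> q || r) -> p <= q + r.
Proof. by case: p q r => [] [] [] // /(_ isT). Qed.

Variable n : nat.

Lemma rot_subproof (v : vertex n) :
  ((val v).1.2 + (val v).2 + (val v).1.1 == n).
Proof. by case: v => -[[a b] c] /= /eqP <-; lia. Qed.

Definition rot (v : vertex n) : vertex n := Sub (_, _, _) (rot_subproof v).

Lemma rotK3 v : rot (rot (rot v)) = v.
Proof. by apply: val_inj; case: v => -[[a b] c]. Qed.

Lemma rot_inj : injective rot.
Proof. by move=> u v uv; rewrite -(rotK3 u) uv rotK3. Qed.

Lemma frozen_rot v : frozen n (rot v) = frozen n v.
Proof. by case: v => -[[a b] c] e; rewrite /frozen /unfrozen /=; lia. Qed.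

Lemma initial_quiver_rot u v :
  initial_quiver n (rot u) (rot v) = initial_quiver n u v.
Proof.
rewrite /initial_quiver /discard_frozen !frozen_rot; congr (if _ then _ else _).
case: u v => -[[a b] c] e [] -[[a' b'] c'] e'; rewrite /step /=.
by congr nat_of_bool; lia.
Qed.

Lemma initial_acyclic2 : acyclic2 (initial_quiver n).
Proof.
move=> [[[a b] c] e] [[[a' b'] c'] e'].
rewrite /initial_quiver /discard_frozen /frozen /unfrozen /step /=.
by case: ifP; case: ifP; lia.
Qed.

Lemma initial_quiver_step (u v : vertex n) : unfrozen u || unfrozen v ->
  initial_quiver n u v = step u v.
Proof.
by rewrite /initial_quiver /discard_frozen /frozen -negb_or => ->.
Qed.

Definition has_optimized_seed (f : vertex n) :=
  exists2 ks, all (predC (frozen n)) ks &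
    optimized (mutate_seq (frozen n) (initial_quiver n) ks) f.

Lemma has_optimized_seed_rot f :
  has_optimized_seed f -> has_optimized_seed (rot f).
Proof.
move=> [ks ks_unfr opt]; exists (map rot ks).
  by rewrite all_map; apply: sub_all ks_unfr => v /=; rewrite frozen_rot.
move=> v; rewrite -(rotK3 v).
rewrite (mutate_seq_transport _ rot_inj frozen_rot initial_quiver_rot).
exact: opt.
Qed.

Lemma has_optimized_seed_side f : (val f).2 = 0 -> has_optimized_seed f.
Proof.
case: f => -[[a b] c] e /= c0; move: e; rewrite {}c0 => e.
have nE : a + b = n by move/eqP: e => /=; lia.
set f := exist _ _ _.
(* In this case (a, b-1, 1) is frozen or absent, so [f] is a sink from the start. *)
have [ab|ab] := boolP ((a == 0) || (b <= 1)).
  exists [::] => // -[[[x y] z] e'].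
  rewrite /= /initial_quiver /discard_frozen /frozen /unfrozen /step /=.
  by case: ifP; move/eqP: e' => /= ?; lia.
pose w j : vertex n := insubd f (a, b.-1 - j, j.+1).
have wE j : j < b -> val (w j) = (a, b.-1 - j, j.+1).
  by move=> jb; rewrite val_insubd /=; case: ifP => //; lia.
have eq_w j v : j < b -> (v == w j) = (val v == (a, b.-1 - j, j.+1)).
  by move=> jb; rewrite -(inj_eq val_inj) wE.
have w_unfr j : j < b.-1 -> unfrozen (w j).
  by move=> jb; rewrite /unfrozen wE; lia.
apply: (@path_optimized _ _ _ f w b.-1).
- exact: initial_acyclic2.
- by rewrite /frozen /unfrozen /=; lia.
- by move=> j /w_unfr; rewrite /frozen => ->.
- by rewrite /frozen /unfrozen wE; lia.
- by move=> i j ij /(congr1 val); rewrite !wE; [case; lia | lia | lia].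
- move=> v; rewrite eq_w; last lia.
  rewrite /initial_quiver /discard_frozen /frozen /unfrozen /step /=.
  case: v => -[[x y] z] /= e'; rewrite !xpair_eqE.
  by case: ifP; lia.
- move=> j jb; rewrite initial_quiver_step ?w_unfr //; last lia.
  by rewrite /step !wE; try lia; case: ifP; lia.
- move=> i j ij; rewrite !initial_quiver_step ?w_unfr ?orbT //; try lia.
  by rewrite /step !wE; lia.
(* The three steps sum to zero and [w j -> w j.+1] is the step (0, -1, 1). After either of the other
   two, the remaining one leads back to [w j]. *)
- move=> j v jb; rewrite eq_w; last lia.
  rewrite !initial_quiver_step ?w_unfr ?orbT //; try lia.
  apply: leq_bool_add; rewrite /step !wE; try lia.
  case: v => -[[x y] z] /= _; rewrite !xpair_eqE.
  by case/or3P => /and3P[/eqP ? /eqP ? /eqP ?]; lia.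
- move=> v b0; rewrite /frozen negbK => v_unfr; rewrite eq_w; last lia.
  rewrite !initial_quiver_step ?v_unfr ?orbT //.
  apply: leq_bool_add; move: v_unfr; rewrite /unfrozen /step wE; last lia.
  case: v => -[[x y] z] /= _ /and3P[? ? ?]; rewrite !xpair_eqE.
  by case/or3P => /and3P[/eqP ? /eqP ? /eqP ?]; lia.
Qed.

End Triangle.

Theorem proposition17 (n : nat) (hn : 1 <= n) (f : vertex n)
    (hf : frozen n f) :
  exists2 Qs : quiver (vertex n),
    seed_quiver (frozen n) (initial_quiver n) Qs & optimized Qs f.
Proof.
suff [ks ks_unfr opt] : has_optimized_seed f.
  by exists (mutate_seq (frozen n) (initial_quiver n) ks); first by exists ks.
have : [|| (val f).1.1 == 0, (val f).1.2 == 0 | (val f).2 == 0].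
  by move: hf; rewrite /frozen /unfrozen; case: (val f) => -[a b] c /=; lia.
(* The last coordinate of [rot f] is the first of [f], and that of [rot (rot f)] is the second. *)
case/or3P => /eqP f0; last exact: has_optimized_seed_side.
  rewrite -(rotK3 f); do 2!apply: has_optimized_seed_rot.
  by apply: has_optimized_seed_side.
rewrite -(rotK3 f); apply: has_optimized_seed_rot.
by apply: has_optimized_seed_side.
Qed.
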